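(* Let $q\ge2$ be an integer, $\beta>0$, $p=1-e^{-\beta}$, and let $C\ge1$ be a constant. Let $G=(V,\mathbb{E})$ be any finite graph with $n=|V|\ge2$ vertices such that the Edwards-Sokal joint measure $\nu$ on $G$ with parameters $p,q$ satisfies approximate spin/edge factorization with constant $C$. Then, for all functions $f:\Omega\to\mathbb{R}_+$, $$\mathrm{Ent}_\mu(P_{SW}f)\le(1-\delta)\,\mathrm{Ent}_\mu(f)\qquad\text{with }\delta=1/C,$$ where $\mu=\mu_{G,\beta}$ is the $q$-state Potts measure on $G$ and $P_{SW}$ is the transition matrix of the Swendsen-Wang dynamics on $G$. Hence $T_{\rm mix}(SW)=O(\log n)$, i.e. there is a constant $K=K(C,q,\beta)$, not depending on $G$ or $n$, with $T_{\rm mix}(SW)\le K\log n$.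
   Context: **Potts model.** $\Omega=\{1,\dots,q\}^V$; for $\sigma\in\Omega$ let $D(\sigma)=\{\{v,w\}\in\mathbb{E}:\sigma_v\ne\sigma_w\}$, $M(\sigma)=\mathbb{E}\setminus D(\sigma)$, and $\mu(\sigma)=\frac1Z e^{-\beta|D(\sigma)|}$ with $Z$ the normalizing constant. **Joint (Edwards-Sokal) measure.** On $\Omega_J=\Omega\times\{0,1\}^{\mathbb{E}}$ (pairs $(\sigma,A)$ with $A\subseteq\mathbb{E}$), $\nu(\sigma,A)=\frac1{Z_J}p^{|A|}(1-p)^{|\mathbb{E}|-|A|}\mathbf{1}(A\subseteq M(\sigma))$, with $Z_J$ the normalizing constant. **Entropy.** For a probability measure $\pi$ and $f\ge0$, $\mathrm{Ent}_\pi(f)=\pi[f\log(f/\pi[f])]$ (with $0\log0=0$). **Approximate spin/edge factorization with constant $C$.** For all $f:\Omega_J\to\mathbb{R}_+$, $\mathrm{Ent}_\nu(f)\le C\big(\nu[\mathrm{Ent}_\nu(f\mid\sigma)]+\nu[\mathrm{Ent}_\nu(f\mid A)]\big)$, where $\mathrm{Ent}_\nu(f\mid\sigma)$, $\mathrm{Ent}_\nu(f\mid A)$ are the entropies of $f$ with respect to $\nu$ conditioned on the whole spin configuration being $\sigma$, respectively on the whole edge configuration being $A$. **Swendsen-Wang (SW) dynamics.** The Markov chain on $\Omega$ which, from $\sigma(t)$: (1) independently keeps each edge of $M(\sigma(t))$ with probability $1-e^{-\beta}$, giving $A(t)\subseteq M(\sigma(t))$; (2) for each connected component of $(V,A(t))$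 independently chooses a uniformly random spin in $\{1,\dots,q\}$ and assigns it to all vertices of the component, giving $\sigma(t+1)$. Its transition matrix is $P_{SW}$, and $(P_{SW}f)(\sigma)=\sum_\tau P_{SW}(\sigma,\tau)f(\tau)$. It is reversible with respect to $\mu$. **Mixing time.** For an ergodic chain $P$ on a finite state space $\Gamma$ with stationary distribution $\pi$, $T_{\rm mix}(P)=\max_{x\in\Gamma}\min\{t\ge0:\|P^t(x,\cdot)-\pi\|_{TV}\le 1/4\}$, with $\|\cdot\|_{TV}$ total variation distance. *)

(* Defs.v *)
From mathcomp Require Import all_boot all_order all_algebra.
From mathcomp Require Import all_classical all_reals all_analysis.

Set Implicit Arguments.
Unset Strict Implicit.
Unset Printing Implicit Defensive.

Import Order.TTheory GRing.Theory Num.Theory.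

Local Open Scope ring_scope.

(** * Finite simple graphs *)

Record sgraph := SGraph {
  vertex :> finType;
  edges : {set {set vertex}};
  card_edges : forall e, e \in edges -> #|e| = 2%N }.

(* Edge configurations, i.e. subsets of the edge set, are the elements of
   {set edge G}. *)
Definition edge (G : sgraph) := {e : {set G} | e \in edges G}.

Notation spin_config q G := {ffun vertex G -> 'I_q}.
Notation edge_config G := {set edge G}.
Notation joint_config q G := (spin_config q G * edge_config G)%type.

(** * Measures on finite sets, given by their mass functions *)

Section FiniteMeasures.
Context {R : realType} {T : finType}.
Implicit Types (pi w f : T -> R) (P : T -> T -> R).

Definition normalize w : T -> R := fun x => w x / \sum_y w y.

Definition mean pi f : R := \sum_x pi x * f x.

(* The convention 0 log 0 = 0 holds because of the factor f x. *)
Definition Ent pi f : R := mean pi (fun x => f x * ln (f x / mean pi f)).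

Definition condition pi (B : {set T}) : T -> R :=
  normalize (fun x => if x \in B then pi x else 0).

Definition tv_dist pi1 pi2 : R := 2^-1 * \sum_x `|pi1 x - pi2 x|.

Definition kernel_app P f : T -> R := fun x => \sum_y P x y * f y.

Fixpoint kernel_pow P (t : nat) : T -> T -> R :=
  if t is s.+1 then fun x y => \sum_z P x z * kernel_pow P s z y
  else fun x y => (x == y)%:R.

(* The infimum of a nonempty set of integers is its minimum; that of the empty
   set is +oo, so that an upper bound on [tmix P pi] by a real number entails
   that the threshold 1/4 is reached from every starting point. *)
Definition tmix P pi : \bar R :=
  \big[maxe/-oo%E]_(x : T)
    ereal_inf [set (t%:R)%:E | t in [set t : nat |
                 tv_dist (kernel_pow P t x) pi <= 4^-1]].

End FiniteMeasures.

(** * Potts model, joint measure and Swendsen-Wang dynamics *)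

Section Models.
Context {R : realType}.
Variables (q : nat) (G : sgraph).
Implicit Types (sigma tau : spin_config q G) (A : edge_config G).

Definition dichromatic sigma : edge_config G :=
  [set e : edge G | [exists v in val e, exists w in val e, sigma v != sigma w]].

Definition monochromatic sigma : edge_config G := ~: dichromatic sigma.

Definition potts (beta : R) : spin_config q G -> R :=
  normalize (fun sigma => expR (- beta * #|dichromatic sigma|%:R)).

Definition joint (p : R) : joint_config q G -> R :=
  normalize (fun w : joint_config q G =>
    p ^+ #|w.2| * (1 - p) ^+ (#|edges G| - #|w.2|)
      * (w.2 \subset monochromatic w.1)%:R).

Definition Ent_given_spins (p : R) (f : joint_config q G -> R) sigma : R :=
  Ent (condition (joint p) [set w : joint_config q G | w.1 == sigma]) f.

Definition Ent_given_edges (p : R) (f : joint_config q G -> R) A : R :=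
  Ent (condition (joint p) [set w : joint_config q G | w.2 == A]) f.

Definition spin_edge_factorization (p C : R) : Prop :=
  forall f : joint_config q G -> R, (forall w, 0 <= f w) ->
    Ent (joint p) f <=
      C * (mean (joint p) (fun w => Ent_given_spins p f w.1)
           + mean (joint p) (fun w => Ent_given_edges p f w.2)).

(* Law of A when the edges of M(sigma) are kept independently with
   probability p. *)
Definition edge_step (p : R) sigma A : R :=
  (A \subset monochromatic sigma)%:R
    * \prod_(e in monochromatic sigma) (if e \in A then p else 1 - p).

Definition open_adj A : rel G := fun v w => [exists e in A, val e == [set v; w]].

Definition components A : {set {set G}} :=
  equivalence_partition (connect (open_adj A)) [set: G].

(* Law of tau: independently for each component B, a uniform spin s is
   assigned to all the vertices of B. *)
Definition spin_step A tau : R :=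
  \prod_(B in components A)
    \sum_(s < q) q%:R^-1 * [forall v in B, tau v == s]%:R.

Definition swendsen_wang (beta : R) sigma tau : R :=
  \sum_(A : edge_config G) edge_step (1 - expR (- beta)) sigma A * spin_step A tau.

End Models.

Arguments potts {R} q G beta _.
Arguments joint {R} q G p _.
Arguments swendsen_wang {R} q G beta _ _.

(* Main.v *)
(* Under nu the spin marginal is mu, the conditional law of A given sigma is
   the edge step K, and that of sigma given A is the spin step L; hence
   P_SW = K L. For f a function of the spins alone, Ent_nu(f | sigma) = 0, so
   the chain rule for entropy and the factorization give
   Ent(L f) = Ent_mu(f) - nu[Ent_nu(f | A)] <= (1 - 1/C) Ent_mu(f), and the
   chain rule again (Jensen) gives Ent_mu(K (L f)) <= Ent(L f).
   For the mixing time, the density of P^t(x, .) with respect to mu is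
   P^t (delta_x / mu(x)) by reversibility; its initial entropy is
   - log mu(x) <= (beta + log q) n^2, so O(log n) steps make the entropy at
   most 1/16, which bounds the total variation distance by 1/4. *)
Require Import Defs.
From mathcomp Require Import all_boot all_order all_algebra.
From mathcomp Require Import all_classical all_reals all_analysis.
From mathcomp Require Import ring lra.

Import Order.TTheory GRing.Theory Num.Theory.

Local Open Scope ring_scope.

(** * Entropy on finite sets: positivity, a total variation bound, the chain rule *)

Section Entropy.
Set Implicit Arguments.
Unset Strict Implicit.
Context {R : realType}.

Definition stochastic (X Y : finType) (K : X -> Y -> R) : Prop :=
  (forall x y, 0 <= K x y) /\ (forall x, \sum_y K x y = 1).

Lemma subr1_ge_ln (x : R) : 0 < x -> ln x <= x - 1.
Proof.
by move=> x0; have := expR_ge1Dx (ln x); rewrite lnK ?posrE //; lra.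
Qed.

(** Multiply [ln x <= x - 1] at [x = m / s] by [s]; at [s = 0] the right-hand side is 0. *)
Lemma subr_le_mulr_ln (s m : R) : 0 <= s -> 0 < m -> s - m <= s * ln (s / m).
Proof.
rewrite le_eqVlt => /predU1P[<- m0|s0 m0]; first by rewrite mul0r; lra.
have : ln (m / s) <= m / s - 1 by apply: subr1_ge_ln; exact: divr_gt0.
rewrite -(invf_div s m) lnV ?posrE ?divr_gt0 // => /(ler_wpM2l (ltW s0)).
by rewrite mulrBr mulr1 invf_div [s * (m / s)]mulrCA divff ?gt_eqF //; lra.
Qed.

(* Through Hellinger's distance, in place of Pinsker's inequality: with
   r = sqrt s, use s ln s - s + 1 >= (r - 1)^2 and AM-GM on |r - 1| (r + 1). *)
Lemma dist1_le (s : R) : 0 <= s ->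
  `|s - 1| <= 4 * (s * ln s - s + 1) + (s + 1) / 8.
Proof.
move=> s0; set r := Num.sqrt s; have r0 : 0 <= r by exact: sqrtr_ge0.
have sr : s = r ^+ 2 by rewrite sqr_sqrtr.
have sln : 2 * s - 2 * r <= s * ln s.
  have [r_eq0|r_neq0] := eqVneq r 0.
    by rewrite sr r_eq0 expr0n /= mul0r !mulr0 subr0.
  have r_gt0 : 0 < r by rewrite lt_neqAle eq_sym r_neq0.
  have := subr_le_mulr_ln r0 (@ltr01 R); rewrite divr1.
  by move/(ler_wpM2l r0); rewrite sr lnXn // mulr2n; lra.
have [s1|s1] := leP 1 s.
  rewrite ger0_norm ?subr_ge0 //.
  (* By [sln], the right side exceeds the left by at least one sixteenth of the sum of these two
     squares; likewise below with [9 * r - 7]. *)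
  have := sqr_ge0 (7 * r - 9); have := sqr_ge0 (r - 1); rewrite !sqrrB; nra.
rewrite ltr0_norm ?subr_lt0 //.
have := sqr_ge0 (9 * r - 7); have := sqr_ge0 (r - 1); rewrite !sqrrB; nra.
Qed.

Section Finite.
Variables (T : finType) (pi : T -> R).
Hypothesis pi_ge0 : forall x, 0 <= pi x.

Lemma mean_ge0 (f : T -> R) : (forall x, 0 <= f x) -> 0 <= mean pi f.
Proof. by move=> f0; apply: sumr_ge0 => x _; exact: mulr_ge0. Qed.

Lemma mean_eq0 (f : T -> R) : (forall x, 0 <= f x) -> mean pi f = 0 ->
  forall x, pi x * f x = 0.
Proof.
move=> f0 m0 x; apply: (psumr_eq0P _ m0) => // y _; exact: mulr_ge0.
Qed.

Lemma EntE (f : T -> R) : (forall x, 0 <= f x) ->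
  Ent pi f = mean pi (fun x => f x * ln (f x)) - mean pi f * ln (mean pi f).
Proof.
move=> f0; rewrite [mean pi f * _]mulr_suml -sumrB; apply: eq_bigr => x _.
(* With zero mean the quotient under [ln] is meaningless, but then every [pi x * f x] vanishes. *)
have [m0|m_neq0] := eqVneq (mean pi f) 0.
  by rewrite !mulrA mean_eq0 // !mul0r subr0.
have m_gt0 : 0 < mean pi f by rewrite lt_neqAle eq_sym m_neq0 mean_ge0.
have [->|f_neq0] := eqVneq (f x) 0; first by rewrite !(mul0r, mulr0) subr0.
have f_gt0 : 0 < f x by rewrite lt_neqAle eq_sym f_neq0 f0.
by rewrite ln_div ?posrE //; ring.
Qed.

Lemma Ent_ge0 (f : T -> R) : \sum_x pi x = 1 -> (forall x, 0 <= f x) ->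
  0 <= Ent pi f.
Proof.
move=> pi1 f0.
(* A sum of total 0, compared with the entropy term by term through [subr_le_mulr_ln]. *)
have : 0 = \sum_x pi x * (f x - mean pi f).
  under eq_bigr do rewrite mulrBr.
  by rewrite sumrB -mulr_suml pi1 mul1r subrr.
move=> ->; apply: ler_sum => x _.
have [m0|m_neq0] := eqVneq (mean pi f) 0.
  by rewrite m0 subr0 mulrA !mean_eq0 // mul0r.
apply: ler_wpM2l => //; apply: subr_le_mulr_ln => //.
by rewrite lt_neqAle eq_sym m_neq0 mean_ge0.
Qed.

(** Average [dist1_le]: as [pi] and [f] have total mass and mean 1, [- s + 1] contributes 0 and
    [(s + 1) / 8] contributes 1/4. *)
Lemma mean_dist1_le (f : T -> R) : \sum_x pi x = 1 -> mean pi f = 1 ->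
  (forall x, 0 <= f x) ->
  mean pi (fun x => `|f x - 1|) <= 4 * Ent pi f + 4^-1.
Proof.
move=> pi1 f1 f0; rewrite EntE // f1 ln1 mulr0 subr0.
apply: (@le_trans _ _ (\sum_x (4 * (pi x * (f x * ln (f x)))
   + ((8^-1 - 4) * (pi x * f x) + (4 + 8^-1) * pi x)))).
  apply: ler_sum => x _; apply: le_trans (ler_wpM2l _ (dist1_le (f0 x))) _ => //.
  lra.
rewrite big_split big_split /= -!mulr_sumr pi1 -/(mean pi f) f1 /mean; lra.
Qed.

End Finite.

Lemma eq_mean (T : finType) (pi1 pi2 f1 f2 : T -> R) :
  pi1 =1 pi2 -> f1 =1 f2 -> mean pi1 f1 = mean pi2 f2.
Proof. by move=> e1 e2; apply: eq_bigr => x _; rewrite e1 e2. Qed.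

Lemma eq_Ent (T : finType) (pi1 pi2 f1 f2 : T -> R) :
  pi1 =1 pi2 -> f1 =1 f2 -> Ent pi1 f1 = Ent pi2 f2.
Proof.
move=> e1 e2; apply: eq_mean => // x.
by rewrite e2 (eq_mean e1 e2).
Qed.

Lemma mean_pushforward (T S : finType) (h : T -> S) (pi : T -> R) (F : S -> R) :
  mean pi (fun x => F (h x)) = mean (fun y => \sum_(x | h x == y) pi x) F.
Proof.
rewrite /mean (partition_big h xpredT) //=; apply: eq_bigr => y _.
by rewrite mulr_suml; apply: eq_bigr => x /eqP ->.
Qed.

Lemma Ent_pushforward (T S : finType) (h : T -> S) (pi : T -> R) (F : S -> R) :
  Ent pi (fun x => F (h x)) = Ent (fun y => \sum_(x | h x == y) pi x) F.
Proof.
by rewrite /Ent [in LHS]mean_pushforward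
  -(mean_pushforward h pi (fun y => F y * ln (F y / _))).
Qed.

(** The balance equation describes one law on [X * Y]; its first marginal is [mu] because [K] is
    stochastic, and it also arises by drawing [y] from [rho], then [x] from [L y]. *)
Lemma mean_disintegrate (X Y : finType) (mu : X -> R) (rho : Y -> R)
    (K : X -> Y -> R) (L : Y -> X -> R) (F : X -> R) :
  (forall x y, mu x * K x y = rho y * L y x) -> stochastic K ->
  mean mu F = mean rho (fun y => mean (L y) F).
Proof.
move=> muK [_ K1].
transitivity (\sum_x \sum_y rho y * (L y x * F x)).
  apply: eq_bigr => x _; under eq_bigr do rewrite mulrA -muK.
  by rewrite -mulr_suml -mulr_sumr K1 mulr1.
by rewrite exchange_big; apply: eq_bigr => y _; rewrite mulr_sumr.
Qed.

Lemma Ent_chain (X Y : finType) (mu : X -> R) (rho : Y -> R)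
    (K : X -> Y -> R) (L : Y -> X -> R) (f : X -> R) :
  (forall x, 0 <= mu x) -> (forall y, 0 <= rho y) ->
  (forall x y, mu x * K x y = rho y * L y x) -> stochastic K -> stochastic L ->
  (forall x, 0 <= f x) ->
  Ent mu f = mean rho (fun y => Ent (L y) f) + Ent rho (fun y => mean (L y) f).
Proof.
move=> mu0 rho0 muK sK [L0 _] f0.
rewrite (EntE mu0 f0) (EntE rho0); last by move=> y; exact: mean_ge0.
(* Once both means over [mu] pass through [rho], the term [m * ln m] of the total mean [m] is common
   to both sides; the other term of [Ent rho] cancels inside each [Ent (L y) f]. *)
rewrite !(mean_disintegrate _ muK sK) addrA; congr (_ - _).
rewrite -big_split; apply: eq_bigr => y _ /=.
by rewrite (EntE (L0 y) f0) -mulrDr subrK.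
Qed.

Lemma Ent_two_step (X Y : finType) (mu : X -> R) (rho : Y -> R)
    (K : X -> Y -> R) (L : Y -> X -> R) (C : R) (f : X -> R) :
  0 < C ->
  (forall x, 0 <= mu x) -> (forall y, 0 <= rho y) ->
  (forall x y, mu x * K x y = rho y * L y x) -> stochastic K -> stochastic L ->
  (forall x, 0 <= f x) ->
  Ent mu f <= C * mean rho (fun y => Ent (L y) f) ->
  Ent mu (kernel_app (fun x z => \sum_y K x y * L y z) f)
    <= (1 - 1 / C) * Ent mu f.
Proof.
move=> C0 mu0 rho0 muK sK sL f0 factor.
have g0 y : 0 <= mean (L y) f by apply: mean_ge0 => //; exact: sL.1.
have PE : kernel_app (fun x z => \sum_y K x y * L y z) f
    =1 fun x => mean (K x) (fun y => mean (L y) f).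
  move=> x; rewrite /kernel_app; under eq_bigr do rewrite mulr_suml.
  rewrite exchange_big; apply: eq_bigr => y _; rewrite mulr_sumr.
  by apply: eq_bigr => z _; rewrite mulrA.
rewrite (eq_Ent (fun=> erefl) PE).
have chainL := Ent_chain mu0 rho0 muK sK sL f0.
(* The chain rule with the two spaces exchanged: averaging by [K] loses a conditional entropy, which
   is nonnegative. *)
have chainK := Ent_chain rho0 mu0 (fun y x => esym (muK x y)) sL sK g0.
have : 0 <= mean mu (fun x => Ent (K x) (fun y => mean (L y) f)).
  by apply: mean_ge0 => // x; apply: Ent_ge0 => //; [exact: sK.1 | exact: sK.2].
move: factor; rewrite -ler_pdivrMl // [C^-1 * _]mulrC -[_ / C]mulr1.
rewrite mulrBl mul1r; lra.
Qed.

End Entropy.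

(** * Mixing of reversible chains whose entropy contracts *)

Section Mixing.
Set Implicit Arguments.
Unset Strict Implicit.
Context {R : realType} {T : finType}.
Variables (P : T -> T -> R) (mu : T -> R).

(** [kernel_pow] splits off the first step; reversing a path makes it the last one, hence this
    form. *)
Lemma kernel_powSr t x y :
  kernel_pow P t.+1 x y = \sum_z kernel_pow P t x z * P z y.
Proof.
elim: t x y => [|t IH] x y.
  rewrite /= (bigD1 y) //= eqxx mulr1 big1 ?addr0 => [|z zy]; last first.
    by rewrite (negPf zy) mulr0.
  rewrite (bigD1 x) //= eqxx mul1r big1 ?addr0 // => z zx.
  by rewrite eq_sym (negPf zx) mul0r.
rewrite [LHS]/=.
under eq_bigr => z _ do rewrite [X in _ * X]IH mulr_sumr.
rewrite exchange_big; apply: eq_bigr => z _ /=.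
by rewrite mulr_suml; apply: eq_bigr => w _; rewrite mulrA.
Qed.

Hypothesis mu_gt0 : forall x, 0 < mu x.
Hypothesis mu1 : \sum_x mu x = 1.
Hypothesis P_stochastic : stochastic P.
Hypothesis P_reversible : forall x y, mu x * P x y = mu y * P y x.

Lemma kernel_pow_reversible t x y :
  mu x * kernel_pow P t x y = mu y * kernel_pow P t y x.
Proof.
elim: t x y => [|t IH] x y.
  by rewrite /= eq_sym; case: eqVneq => [->|_] //; rewrite !mulr0.
rewrite kernel_powSr /= !mulr_sumr; apply: eq_bigr => z _.
by rewrite mulrA IH mulrAC P_reversible -mulrA.
Qed.

(* By reversibility, the density of the law at time t started from x is the
   t-th iterate under P of the density of the Dirac mass at x. *)
Definition density (x : T) (t : nat) (y : T) : R := kernel_pow P t y x / mu x.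

Lemma kernel_pow_density t x y : kernel_pow P t x y = mu y * density x t y.
Proof.
by rewrite mulrA -kernel_pow_reversible mulrAC divff ?mul1r // gt_eqF.
Qed.

Lemma densityS x t : density x t.+1 =1 kernel_app P (density x t).
Proof.
by move=> y; rewrite /density /= mulr_suml; apply: eq_bigr => z _; rewrite mulrA.
Qed.

Lemma density_ge0 x t y : 0 <= density x t y.
Proof.
apply: divr_ge0; last exact: ltW.
elim: t y => [|t IH] y /=; first exact: ler0n.
by apply: sumr_ge0 => z _; apply: mulr_ge0 => //; exact: P_stochastic.1.
Qed.

Lemma mean_density x t : mean mu (density x t) = 1.
Proof.
elim: t => [|t <-].
  rewrite /mean (bigD1 x) //= big1 ?addr0 => [|y yx].
    by rewrite /density /= eqxx mul1r divff // gt_eqF.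
  by rewrite /density /= (negPf yx) mul0r mulr0.
(* Reversibility is the balance equation with both spaces equal to [T]; disintegration then says
   that [mu] is stationary. *)
rewrite (mean_disintegrate (density x t) P_reversible P_stochastic).
by apply: eq_mean => // y; rewrite densityS.
Qed.

Lemma Ent_density0 x : Ent mu (density x 0) = - ln (mu x).
Proof.
rewrite /Ent mean_density /mean (bigD1 x) //= big1 ?addr0 => [|y yx].
  rewrite /density /= eqxx divr1 mul1r mulrA divff ?gt_eqF // mul1r.
  by rewrite lnV ?posrE.
by rewrite /density /= (negPf yx) !mul0r mulr0.
Qed.

(** The entropy of the density decays like [r ^+ t] from [- ln (mu x)]. The threshold 1/16 fits
    [mean_dist1_le]: half of 4/16 + 1/4 is 1/4. *)
Lemma tmix_le (r : R) (t : nat) :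
  0 <= r ->
  (forall f : T -> R, (forall x, 0 <= f x) ->
     Ent mu (kernel_app P f) <= r * Ent mu f) ->
  (forall x, r ^+ t * - ln (mu x) <= 16^-1) ->
  (tmix P mu <= t%:R%:E)%E.
Proof.
move=> r0 contr t_large; apply: bigmax_le => [|x _]; first exact: leNye.
apply: ereal_inf_lbound; exists t => //=.
have mu_ge0 y : 0 <= mu y by exact: ltW.
have Ent_t s : Ent mu (density x s) <= r ^+ s * - ln (mu x).
  elim: s => [|s IH]; first by rewrite expr0 mul1r Ent_density0.
  rewrite (eq_Ent (fun=> erefl) (densityS x s)) exprS -mulrA.
  apply: le_trans (ler_wpM2l r0 IH); apply: contr => y; exact: density_ge0.
have := mean_dist1_le mu_ge0 mu1 (mean_density x t) (density_ge0 x t).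
have -> : tv_dist (kernel_pow P t x) mu
    = 2^-1 * mean mu (fun y => `|density x t y - 1|).
  congr (_ * _); apply: eq_bigr => y _.
  by rewrite kernel_pow_density -{2}[mu y]mulr1 -mulrBr normrM ger0_norm.
by have := Ent_t t; have := t_large x; lra.
Qed.

End Mixing.

(** * A joint weight factored in both directions, and the resulting two-step chain *)

Section Disintegration.
Set Implicit Arguments.
Unset Strict Implicit.
Context {R : realType} {X Y : finType}.
Variables (w : X * Y -> R) (a : X -> R) (c : Y -> R).
Variables (K : X -> Y -> R) (L : Y -> X -> R).
Hypotheses (a_gt0 : forall x, 0 < a x) (c_gt0 : forall y, 0 < c y).
Hypotheses (K_stochastic : stochastic K) (L_stochastic : stochastic L).
Hypotheses (wK : forall x y, w (x, y) = a x * K x y)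
           (wL : forall x y, w (x, y) = c y * L y x).

Lemma fst_preimage (F : X * Y -> R) x :
  \sum_(z | z.1 == x) F z = \sum_y F (x, y).
Proof.
rewrite (eq_bigl (fun z => (z.1 == x) && true)); last by move=> z; rewrite andbT.
rewrite (eq_bigr (fun z => F (z.1, z.2))); last by case.
by rewrite -(pair_big (pred1 x) xpredT (fun x y => F (x, y))) /= big_pred1_eq.
Qed.

Lemma sum_weight : \sum_z w z = \sum_x a x.
Proof.
rewrite (partition_big fst xpredT) //=; apply: eq_bigr => x _.
rewrite (fst_preimage w); under eq_bigr do rewrite wK.
by rewrite -mulr_sumr K_stochastic.2 mulr1.
Qed.

Lemma sum_weight_fst x : \sum_(z | z.1 == x) normalize w z = normalize a x.
Proof.
rewrite (fst_preimage (normalize w)) /normalize -mulr_suml sum_weight.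
by under eq_bigr do rewrite wK; rewrite -mulr_sumr K_stochastic.2 mulr1.
Qed.

Lemma snd_preimage (F : X * Y -> R) y :
  \sum_(z | z.2 == y) F z = \sum_x F (x, y).
Proof.
rewrite (eq_bigr (fun z => F (z.1, z.2))); last by case.
rewrite -(pair_big xpredT (pred1 y) (fun x y => F (x, y))) /=.
by apply: eq_bigr => x _; rewrite big_pred1_eq.
Qed.

(** The denominator stays [\sum_z w z], the normalizing constant shared with the first marginal. *)
Lemma sum_weight_snd y : \sum_(z | z.2 == y) normalize w z = c y / \sum_z w z.
Proof.
rewrite (snd_preimage (normalize w)) /normalize -mulr_suml.
by under eq_bigr do rewrite wL; rewrite -mulr_sumr L_stochastic.2 mulr1.
Qed.

(** The point [x] witnesses that [X] is inhabited; over an empty [X] the sum would be 0. *)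
Lemma sum_weight_gt0 (x : X) : 0 < \sum_z w z.
Proof.
rewrite sum_weight (bigD1 x) //=; apply: ltr_wpDr => //.
by apply: sumr_ge0 => y _; exact: ltW.
Qed.

Lemma normalize_gt0 x : 0 < normalize a x.
Proof. by rewrite divr_gt0 // -sum_weight (sum_weight_gt0 x). Qed.

(** Given the first coordinate, that coordinate is deterministic; this Dirac mass makes the
    conditional entropy of a function of it vanish. *)
Lemma condition_fst x x' :
  \sum_(z | z.1 == x') condition (normalize w) [set z | z.1 == x]%SET z
    = (x' == x)%:R.
Proof.
rewrite /condition {1}/normalize -mulr_suml -[X in _ / X]big_mkcond.
under [X in _ / X]eq_bigl do rewrite inE.
rewrite sum_weight_fst; have [->|x'x] := eqVneq x' x.
  rewrite (eq_bigr (normalize w)) => [|z /eqP zx]; last by rewrite inE zx eqxx.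
  by rewrite sum_weight_fst divff // gt_eqF // normalize_gt0.
rewrite big1 ?mul0r // => z /eqP zx.
by rewrite inE zx (negPf x'x).
Qed.

(** Bayes' rule: the weight [c y * L y x] of the point, divided by the weight [c y] of its slice. *)
Lemma condition_snd y x :
  \sum_(z | z.1 == x) condition (normalize w) [set z | z.2 == y]%SET z = L y x.
Proof.
rewrite /condition {1}/normalize -mulr_suml -[X in _ / X]big_mkcond.
under [X in _ / X]eq_bigl do rewrite inE.
rewrite sum_weight_snd.
rewrite (fst_preimage (fun z => if z \in [set z | z.2 == y]%SET then _ else _)).
under eq_bigr do rewrite inE /=; rewrite -big_mkcond big_pred1_eq /normalize wL.
have w_neq0 := lt0r_neq0 (sum_weight_gt0 x); have c_neq0 := lt0r_neq0 (c_gt0 y).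
by field; rewrite w_neq0.
Qed.

Lemma normalize_detailed_balance x y :
  normalize a x * K x y = c y / (\sum_z w z) * L y x.
Proof. by rewrite mulrAC -wK wL sum_weight mulrAC. Qed.

(** For each intermediate [y], the path weight is proportional to [c y * L y x * L y z], symmetric
    in [x] and [z]. *)
Lemma two_step_reversible x z :
  normalize a x * (\sum_y K x y * L y z) = normalize a z * \sum_y K z y * L y x.
Proof.
rewrite !mulr_sumr; apply: eq_bigr => y _.
by rewrite !mulrA !normalize_detailed_balance mulrAC.
Qed.

Lemma two_step_stochastic : stochastic (fun x z => \sum_y K x y * L y z).
Proof.
split=> [x z|x].
  apply: sumr_ge0 => y _; apply: mulr_ge0; first exact: K_stochastic.1.
  exact: L_stochastic.1.
rewrite exchange_big /= -(K_stochastic.2 x); apply: eq_bigr => y _.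
by rewrite -mulr_sumr L_stochastic.2 mulr1.
Qed.

(** [F] ignores the second coordinate, so its entropies given [x] vanish and the others are
    entropies of [f] under pushforwards; this leaves the hypothesis of [Ent_two_step]. *)
Lemma factorization_contraction (C : R) (f : X -> R) :
  0 < C -> (forall x, 0 <= f x) ->
  let F := fun z : X * Y => f z.1 in
  Ent (normalize w) F <=
    C * (mean (normalize w)
           (fun z => Ent (condition (normalize w) [set u | u.1 == z.1]%SET) F)
         + mean (normalize w)
           (fun z => Ent (condition (normalize w) [set u | u.2 == z.2]%SET) F)) ->
  Ent (normalize a) (kernel_app (fun x z => \sum_y K x y * L y z) f)
    <= (1 - 1 / C) * Ent (normalize a) f.
Proof.
move=> C0 f0 F.
have Ent_fst x : Ent (condition (normalize w) [set u | u.1 == x]%SET) F = 0.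
  rewrite Ent_pushforward (eq_Ent (condition_fst x) (fun=> erefl)).
  rewrite EntE //.
  have dirac (h : X -> R) : mean (fun z => (z == x)%:R) h = h x.
    rewrite /mean (bigD1 x) //= eqxx mul1r big1 ?addr0 // => z zx.
    by rewrite (negPf zx) mul0r.
  by rewrite !dirac subrr.
have Ent_snd y :
    Ent (condition (normalize w) [set u | u.2 == y]%SET) F = Ent (L y) f.
  by rewrite Ent_pushforward; apply: eq_Ent => // x; exact: condition_snd.
rewrite (eq_mean (fun=> erefl) (fun z => Ent_fst z.1)).
rewrite (eq_mean (fun=> erefl) (fun z => Ent_snd z.2)).
rewrite (mean_pushforward snd (normalize w) (fun y => Ent (L y) f)).
rewrite (eq_mean sum_weight_snd (fun=> erefl)).
rewrite Ent_pushforward (eq_Ent sum_weight_fst (fun=> erefl)).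
rewrite [mean _ (fun=> 0)]big1 ?add0r => [|z _]; last by rewrite mulr0.
have w0 : 0 <= \sum_z w z.
  by rewrite sum_weight; apply: sumr_ge0 => x _; exact: ltW.
apply: Ent_two_step => // [x|y|]; first exact/ltW/normalize_gt0.
  by rewrite divr_ge0 // ltW.
exact: normalize_detailed_balance.
Qed.

End Disintegration.

(** * Clusters, the edge and spin steps, and the two factorizations of the joint weight *)

Section SwendsenWang.
Set Implicit Arguments.
Unset Strict Implicit.
Context {R : realType}.
Variables (q : nat) (G : sgraph).
Hypothesis q_gt0 : (0 < q)%N.
Implicit Types (sigma tau : spin_config q G) (A : edge_config G).

Lemma connect_open_sym A : connect_sym (open_adj A).
Proof. by apply: sym_connect_sym => v w; rewrite /open_adj finset.setUC. Qed.

(** Forward by induction along open paths; backward because the endpoints of an open edge are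
    connected. *)
Lemma subset_monochromaticP A tau :
  reflect (forall v w, connect (open_adj A) v w -> tau v = tau w)
          (A \subset monochromatic tau).
Proof.
apply: (iffP fintype.subsetP) => [Atau v w /connectP[s]|tauA e eA].
  elim: s v => [|x s IH] v /=; first by move=> _ ->.
  case/andP => /existsP[e /andP[eA /eqP e_vx]] /IH{}IH /IH <-.
  have := Atau e eA; rewrite !inE negb_exists => /forallP/(_ v).
  rewrite e_vx set21 negb_exists => /forallP/(_ x).
  by rewrite set22 /= negbK => /eqP.
rewrite !inE; apply/negP => /existsP[v /andP[ve /existsP[w /andP[we]]]].
have /cards2P[x [y [_ e_xy]]] : #|val e| == 2%N by rewrite (card_edges (valP e)).
have tau_xy : tau x = tau y.
  by apply/tauA/connect1/existsP; exists e; rewrite eA e_xy eqxx.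
move: ve we; rewrite e_xy !inE.
by do 2![case/orP => /eqP->]; rewrite ?tau_xy eqxx.
Qed.

(** Written in the exact shape of a block of [equivalence_partition]. *)
Definition component A v : {set G} := [set w in [set: G] | connect (open_adj A) v w].

Lemma componentsP A (B : {set G}) :
  reflect (exists v, B = component A v) (B \in components A).
Proof.
apply: (iffP imsetP) => [[v _ ->]|[v ->]]; first by exists v.
by exists v; rewrite ?inE.
Qed.

Lemma mem_component A v w : (w \in component A v) = connect (open_adj A) v w.
Proof. by rewrite !inE. Qed.

Lemma eq_component A v w : connect (open_adj A) v w -> component A v = component A w.
Proof.
move=> vw; apply/setP => x; rewrite !mem_component.
exact: (same_connect (connect_open_sym A) vw).
Qed.

(** If [tau] is constant on clusters, one spin survives in each factor; otherwise the factor of some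
    cluster is 0. Thus [spin_step A] is uniform on the configurations compatible with [A]. *)
Lemma spin_stepE A tau :
  spin_step A tau =
    q%:R^-1 ^+ #|components A| * (A \subset monochromatic tau)%:R :> R.
Proof.
rewrite /spin_step; case: subset_monochromaticP => [tauA|].
  rewrite mulr1 -prodr_const; apply: eq_bigr => B /componentsP[v ->].
  rewrite (bigD1 (tau v)) //= big1 ?addr0 => [|s sv].
    rewrite (_ : [forall _ in _, _]) ?mulr1 //.
    by apply/forallP => w; apply/implyP; rewrite mem_component => /tauA ->.
  case: forallP => [/(_ v)|_]; last by rewrite mulr0.
  by rewrite mem_component connect0 /= eq_sym (negPf sv).
move=> /existsNP[v /existsNP[w /not_implyP[vw tau_vw]]].
rewrite mulr0; apply/eqP/prodf_eq0; exists (component A v).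
  by apply/componentsP; exists v.
apply/eqP/big1 => s _; case: forallP => [const|_]; last by rewrite mulr0.
case: tau_vw; have := const v; have := const w.
by rewrite !mem_component vw connect0 /= => /eqP -> /eqP ->.
Qed.

Lemma sum_uniform_spin : \sum_(s < q) q%:R^-1 = 1 :> R.
Proof.
rewrite sumr_const card_ord -[_ *+ _]mulr_natl divff //.
by rewrite pnatr_eq0 -lt0n.
Qed.

(** Expand the product of sums into a sum over draws [phi] of a spin for every set of vertices; each
    draw determines exactly one [tau]. *)
Lemma spin_step_stochastic : stochastic (@spin_step R q G).
Proof.
split=> [A tau|A].
  by rewrite spin_stepE mulr_ge0 ?exprn_ge0 ?invr_ge0.
(* Sets that are not clusters also draw a spin, which is ignored, so that [phi] ranges over a full
   function space. *)
pose F (B : {set G}) (s : 'I_q) tau : R :=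
  if B \in components A then [forall v in B, tau v == s]%:R else 1.
have stepE tau : spin_step A tau
    = \sum_(phi : {ffun {set G} -> 'I_q}) \prod_B (q%:R^-1 * F B (phi B) tau).
  rewrite -(bigA_distr_bigA (fun B s => q%:R^-1 * F B s tau)).
  rewrite /spin_step big_mkcond; apply: eq_bigr => B _; rewrite /F.
  by case: ifP => // _; under eq_bigr do rewrite mulr1; rewrite sum_uniform_spin.
under eq_bigr do rewrite stepE.
rewrite exchange_big /=.
transitivity (\sum_(phi : {ffun {set G} -> 'I_q}) \prod_(B : {set G}) (q%:R^-1 : R)).
  apply: eq_bigr => phi _; under eq_bigr do rewrite big_split.
  rewrite -mulr_sumr -[RHS]mulr1; congr (_ * _).
  rewrite (bigD1 [ffun v => phi (component A v)]) //=.
  rewrite big1 ?mul1r => [|B _]; last first.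
    rewrite /F; case: componentsP => // -[v ->].
    rewrite (_ : [forall _ in _, _]) //; apply/forallP => w; apply/implyP.
    by rewrite mem_component ffunE => /eq_component ->.
  rewrite big1 ?addr0 // => tau tau_phi; apply/eqP/prodf_eq0.
  have /existsP[v tau_v] : [exists v, tau v != phi (component A v)].
    apply: contraR tau_phi; rewrite negb_exists => /forallP tauE.
    by apply/eqP/ffunP => v; rewrite ffunE; apply/eqP; rewrite -[_ == _]negbK tauE.
  exists (component A v) => //; rewrite /F ifT; last by apply/componentsP; exists v.
  rewrite (_ : [forall _ in _, _] = false) //; apply/forallP => /(_ v).
  by rewrite mem_component connect0 /= (negPf tau_v).
rewrite -(bigA_distr_bigA (fun (_ : {set G}) (_ : 'I_q) => q%:R^-1 : R)).
by rewrite big1 // => B _; exact: sum_uniform_spin.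
Qed.

Lemma edge_step_stochastic (p : R) : 0 <= p <= 1 -> stochastic (@edge_step R q G p).
Proof.
move=> /andP[p0 p1]; split=> [sigma A|sigma].
  apply: mulr_ge0 => //; apply: prodr_ge0 => e _.
  by case: ifP => // _; rewrite subr_ge0.
(* Bichromatic edges get weight 0 if kept and 1 if dropped; expanding the product over all edges
   then yields every [A]. *)
transitivity (\prod_(e : edge G)
   ((if e \in monochromatic sigma then p else 0)
    + (if e \in monochromatic sigma then 1 - p else 1))); last first.
  by rewrite big1 // => e _; case: ifP => _; rewrite ?add0r // addrC subrK.
rewrite bigA_distr; apply: eq_bigr => A _; rewrite /edge_step.
have [AM|/fintype.subsetPn[e eA eM]] := boolP (A \subset monochromatic sigma).
  rewrite mul1r big_mkcond; apply: eq_bigr => e _.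
  by have [/(fintype.subsetP AM) ->|] := boolP (e \in A) => //; case: ifP.
by rewrite mul0r; apply/esym/eqP/prodf_eq0; exists e; rewrite // eA (negPf eM).
Qed.

Lemma card_edge : #|{: edge G}| = #|edges G|.
Proof. by rewrite card_sig; apply: eq_card => e; rewrite inE. Qed.

Lemma leq_card_edges : (#|edges G| <= #|G| ^ 2)%N.
Proof.
rewrite -mulnn -card_prod -cardsT.
apply: leq_trans (leq_imset_card (fun v : G * G => [set v.1; v.2]%SET) _).
apply/subset_leq_card/fintype.subsetP => e /card_edges/eqP/cards2P[v [w [_ ->]]].
by apply/imsetP; exists (v, w).
Qed.

(** When [A] lies in the monochromatic edges, the edges outside [A] are the dichromatic ones and the
    dropped monochromatic ones, so the exponents of [1 - p] add up. *)
Lemma joint_weight_edge_step (p : R) sigma A :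
  p ^+ #|A| * (1 - p) ^+ (#|edges G| - #|A|) * (A \subset monochromatic sigma)%:R
  = (1 - p) ^+ #|dichromatic sigma| * edge_step p sigma A.
Proof.
rewrite /edge_step; have [AM|_] := boolP (A \subset _); last by rewrite mul0r !mulr0.
rewrite mulr1 mul1r (big_setID A) /= (finset.setIidPr AM).
rewrite (eq_bigr (fun=> p)) => [|e ->] //.
rewrite [X in _ * (_ * X)](eq_bigr (fun=> 1 - p)) => [|e]; last first.
  by rewrite !inE => /andP[/negPf ->].
rewrite !prodr_const mulrCA -exprD; congr (_ * _ ^+ _).
rewrite cardsDS // -card_edge -(cardsC (dichromatic sigma)) -/(monochromatic sigma).
by rewrite addnBA // subset_leq_card.
Qed.

(** The prefactor of [spin_step] is the random-cluster weight of [A]: its power of [q] counts the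
    compatible spin configurations. *)
Lemma joint_weight_spin_step (p : R) sigma A :
  p ^+ #|A| * (1 - p) ^+ (#|edges G| - #|A|) * (A \subset monochromatic sigma)%:R
  = p ^+ #|A| * (1 - p) ^+ (#|edges G| - #|A|) * q%:R ^+ #|components A|
    * spin_step A sigma.
Proof.
rewrite spin_stepE exprVn -!mulrA; congr (_ * (_ * _)).
rewrite mulrA divff ?mul1r // expf_neq0 // pnatr_eq0 -lt0n //.
Qed.

(** Each Boltzmann weight is at most 1, so the partition function is at most [q ^ #|G|]; the
    exponent at [sigma] is at most [beta * #|G| ^ 2]. *)
Lemma potts_ln_ge (beta : R) sigma : 0 <= beta ->
  - ln (potts q G beta sigma) <= (beta + ln q%:R) * #|G|%:R ^+ 2.
Proof.
move=> beta0; set a := fun tau => expR (- beta * #|dichromatic tau|%:R).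
have Z_ge : a sigma <= \sum_tau a tau.
  rewrite (bigD1 sigma) //= lerDl; apply: sumr_ge0 => tau _; exact: expR_ge0.
have Z_gt0 : 0 < \sum_tau a tau by apply: lt_le_trans Z_ge; exact: expR_gt0.
have Z_le : \sum_tau a tau <= q%:R ^+ #|G|.
  rewrite -natrX -[X in (X ^ _)%N]card_ord -card_ffun -sum1_card natr_sum.
  apply: ler_sum => tau _; rewrite -expR0 ler_expR mulNr oppr_le0.
  exact: mulr_ge0.
have qR : 0 < q%:R :> R by rewrite ltr0n.
have lnZ : ln (\sum_tau a tau) <= ln q%:R * #|G|%:R.
  rewrite mulr_natr -lnXn // ler_ln ?posrE // exprn_gt0 //.
have D_le : (#|dichromatic sigma| <= #|G| ^ 2)%N.
  by apply: leq_trans (max_card _) _; rewrite card_edge leq_card_edges.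
have D_leR : #|dichromatic sigma|%:R <= #|G|%:R ^+ 2 :> R by rewrite -natrX ler_nat.
rewrite /potts /normalize -/a ln_div ?posrE ?expR_gt0 // expRK opprB mulNr opprK.
have lnq : 0 <= ln q%:R :> R by rewrite ln_ge0 // ler1n.
rewrite mulrDl addrC lerD ?ler_wpM2l //; apply: le_trans lnZ _.
rewrite ler_wpM2l // -natrX ler_nat expnS expn1.
by case: #|G| => // n; exact: leq_pmulr.
Qed.

End SwendsenWang.

(** * Contraction and mixing time for the Potts model *)

Section PottsDynamics.
Set Implicit Arguments.
Unset Strict Implicit.
Context {R : realType}.
Variables (q : nat) (G : sgraph) (beta : R).
Hypotheses (q_gt0 : (0 < q)%N) (beta_gt0 : 0 < beta).

Let p := 1 - expR (- beta).
(** [a] and [weight] copy the weights inside [potts] and [joint], so the disintegration results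
    apply by conversion. *)
Let a (sigma : spin_config q G) := expR (- beta * #|dichromatic sigma|%:R).
Let c (A : edge_config G) : R :=
  p ^+ #|A| * (1 - p) ^+ (#|edges G| - #|A|) * q%:R ^+ #|components A|.
Let weight (w : joint_config q G) : R :=
  p ^+ #|w.2| * (1 - p) ^+ (#|edges G| - #|w.2|)
    * (w.2 \subset monochromatic w.1)%:R.

Let p_gt0 : 0 < p.
Proof. by rewrite subr_gt0 -expR0 ltr_expR oppr_lt0. Qed.

Let subr1p : 1 - p = expR (- beta).
Proof. by rewrite /p subKr. Qed.

Let a_gt0 sigma : 0 < a sigma.
Proof. exact: expR_gt0. Qed.

Let c_gt0 A : 0 < c A.
Proof. by rewrite !mulr_gt0 ?exprn_gt0 ?subr1p ?expR_gt0 ?ltr0n. Qed.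

Let edge_stoch : stochastic (@edge_step R q G p).
Proof.
by apply: edge_step_stochastic; rewrite ltW //= -subr_ge0 subr1p expR_ge0.
Qed.

Let spin_stoch : stochastic (@spin_step R q G).
Proof. exact: spin_step_stochastic. Qed.

Let weight_edge sigma A : weight (sigma, A) = a sigma * edge_step p sigma A.
Proof.
rewrite /weight /= joint_weight_edge_step subr1p /a; congr (_ * _).
by rewrite -expRM_natl mulrC.
Qed.

Let weight_spin sigma A : weight (sigma, A) = c A * spin_step A sigma.
Proof. exact: joint_weight_spin_step. Qed.

Lemma potts_gt0 sigma : 0 < potts q G beta sigma.
Proof. exact: (normalize_gt0 a_gt0 edge_stoch weight_edge). Qed.

Lemma sum_potts : \sum_sigma potts q G beta sigma = 1.
Proof.
rewrite /potts /normalize -mulr_suml -/a divff //.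
(* A constant configuration, showing that the total weight is nonzero. *)
pose sigma0 : spin_config q G := [ffun=> Ordinal q_gt0].
rewrite -(sum_weight edge_stoch weight_edge) gt_eqF //.
exact: (sum_weight_gt0 a_gt0 edge_stoch weight_edge sigma0).
Qed.

Lemma swendsen_wang_reversible sigma tau :
  potts q G beta sigma * swendsen_wang q G beta sigma tau
  = potts q G beta tau * swendsen_wang q G beta tau sigma.
Proof. exact: (two_step_reversible edge_stoch weight_edge weight_spin). Qed.

Lemma swendsen_wang_stochastic : stochastic (@swendsen_wang R q G beta).
Proof. exact: (two_step_stochastic edge_stoch spin_stoch). Qed.

Lemma Ent_swendsen_wang (C : R) (f : spin_config q G -> R) :
  0 < C -> spin_edge_factorization q G p C -> (forall sigma, 0 <= f sigma) ->
  Ent (potts q G beta) (kernel_app (swendsen_wang q G beta) f)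
    <= (1 - 1 / C) * Ent (potts q G beta) f.
Proof.
move=> C0 factor f0.
apply: (factorization_contraction a_gt0 c_gt0 edge_stoch spin_stoch
  weight_edge weight_spin) => //.
exact: (factor (fun w => f w.1)).
Qed.

Lemma tmix_swendsen_wang (C M : R) :
  (2 <= #|G|)%N -> 1 <= C -> beta + ln q%:R <= M -> 1 <= M ->
  spin_edge_factorization q G p C ->
  (tmix (swendsen_wang q G beta) (potts q G beta)
    <= (((C * ln (16 * M) + 1) / ln 2 + 2 * C) * ln #|G|%:R)%:E)%E.
Proof.
move=> G2 C1 leM M1 factor; set n : R := #|G|%:R.
have C0 : 0 < C by lra.
have n2 : 2 <= n by rewrite ler_nat.
have n0 : 0 < n by lra.
have ln2 : 0 < ln 2 :> R by rewrite ln_gt0 // ltr1n.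
have lnn : ln 2 <= ln n by rewrite ler_ln // posrE.
have lnM0 : 0 <= ln (16 * M) by rewrite ln_ge0 //; lra.
(* [s] is [C * ln (16 * M * n ^+ 2)], the time at which [expR (- s / C)] brings the initial entropy
   bound [M * n ^+ 2] down to 1/16. *)
pose s := C * (ln (16 * M) + 2 * ln n).
have s0 : 0 <= s by rewrite mulr_ge0 //; lra.
pose t := (Num.truncn s).+1.
have st : s <= t%:R by apply/ltW; exact: truncnS_gt.
have ts : t%:R <= s + 1.
  by rewrite -natr1 lerD2r; have /andP[] := truncn_itv s0.
apply: (@le_trans _ _ (t%:R)%:E); last first.
  rewrite lee_fin; apply: le_trans ts _.
  (* Since [n >= 2], the constant term, including the 1 from rounding, is absorbed by a multiple of
     [ln n]. *)
  have : C * ln (16 * M) + 1 <= (C * ln (16 * M) + 1) / ln 2 * ln n.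
    rewrite mulrAC ler_pdivlMr // ler_wpM2l //.
    by rewrite addr_ge0 // mulr_ge0 // ltW.
  by rewrite /s; lra.
have r0 : 0 <= 1 - 1 / C by rewrite subr_ge0 ler_pdivrMr ?mul1r.
apply: (tmix_le potts_gt0 sum_potts swendsen_wang_stochastic
  swendsen_wang_reversible r0) => [f f0|sigma]; first exact: Ent_swendsen_wang.
(* Through [1 - 1 / C <= expR (- C^-1)] and [s <= t]. *)
have r_exp : (1 - 1 / C) ^+ t <= (16 * M * n ^+ 2)^-1.
  apply: (@le_trans _ _ (expR (- C^-1) ^+ t)).
    by rewrite lerXn2r ?nnegrE ?expR_ge0 // div1r expR_ge1Dx.
  rewrite -expRM_natl -[leRHS]lnK ?posrE ?invr_gt0; last first.
    by rewrite mulr_gt0 ?exprn_gt0 //; lra.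
  rewrite ler_expR lnV ?posrE; last by rewrite mulr_gt0 ?exprn_gt0 //; lra.
  rewrite mulrN lerN2 lnM ?posrE ?exprn_gt0 //; last lra.
  by rewrite lnXn // ler_pdivlMr // mulr2n; move: st; rewrite /s; lra.
have mu_le : - ln (potts q G beta sigma) <= M * n ^+ 2.
  apply: le_trans (potts_ln_ge q_gt0 sigma (ltW beta_gt0)) _.
  by rewrite ler_wpM2r // exprn_ge0 // ltW.
have Mn0 : 0 < M * n ^+ 2 by rewrite mulr_gt0 ?exprn_gt0 //; lra.
apply: le_trans (ler_wpM2l (exprn_ge0 t r0) mu_le) _.
apply: le_trans (ler_wpM2r (ltW Mn0) r_exp) _.
rewrite -mulrA invfM -mulrA mulVf ?mulr1 //; exact: lt0r_neq0.
Qed.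

End PottsDynamics.

Theorem lemma1p8 (R : realType) (q : nat) (beta p C : R)
    (hq : (2 <= q)%N) (hbeta : 0 < beta) (hp : p = 1 - expR (- beta))
    (hC : 1 <= C) :
  (forall G : sgraph, (2 <= #|G|)%N -> spin_edge_factorization q G p C ->
     forall f : spin_config q G -> R, (forall sigma, 0 <= f sigma) ->
       Ent (potts q G beta) (kernel_app (swendsen_wang q G beta) f)
         <= (1 - 1 / C) * Ent (potts q G beta) f)
  /\
  (exists K : R, forall G : sgraph, (2 <= #|G|)%N ->
     spin_edge_factorization q G p C ->
     (tmix (swendsen_wang q G beta) (potts q G beta) <= (K * ln (#|G|%:R))%:E)%E).
Proof.
subst p; have q0 : (0 < q)%N by exact: ltnW.
split=> [G _ factor f f0|].
  by apply: Ent_swendsen_wang => //; exact: lt_le_trans hC.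
have lnq : 0 <= ln q%:R :> R by rewrite ln_ge0 // ler1n.
(* The summand 1 ensures [1 <= M]; no graph enters [M], so the constant is chosen before [G]. *)
set M := 1 + beta + ln q%:R.
exists ((C * ln (16 * M) + 1) / ln 2 + 2 * C) => G G2 factor.
by apply: tmix_swendsen_wang => //; rewrite /M; lra.
Qed.
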